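(* Let $n$ be an odd positive integer, $m=\frac{n-1}{2}$, and let $F(X)=X^d$ over $\mathbb{F}_{3^n}$, where $d=2\cdot 3^{m}+1$. Then for $a,b\in\mathbb{F}_{3^n}$, $$\nabla_F(a,b)=\begin{cases} 3^n & \text{if } ab=0,\\ 3 & \text{if } ab\neq 0 \text{ and } \left(\dfrac{-ab^{3^m}}{ab^{3^m}+a^{3^m}b}\right)^{1+3^m+3^{2m}+\cdots+3^{2m^2}}=1,\\ 1 & \text{otherwise,} \end{cases}$$ where the exponent is $\sum_{j=0}^{n-1}3^{jm}$ (note $(n-1)m=2m^2$). Moreover, $F$ is second-order zero differentially $3$-uniform, i.e. $\nabla_F=3$.
   Context: For $F:\mathbb{F}_{q}\to\mathbb{F}_{q}$ with $q=p^n$, $p$ odd, and $a,b\in\mathbb{F}_q$, set $\nabla_F(a,b)=\#\{X\in\mathbb{F}_q: F(X+a+b)-F(X+b)-F(X+a)+F(X)=0\}$. The second-order zero differential uniformity of $F$ is $\nabla_F=\max\{\nabla_F(a,b): a,b\in\mathbb{F}_q\setminus\{0\}\}$, and $F$ is called second-order zero differentially $k$-uniform if $\nabla_F=k$. *)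

(* Defs.v *)
From mathcomp Require Import all_boot all_order all_algebra.

Set Implicit Arguments.
Unset Strict Implicit.
Unset Printing Implicit Defensive.

Import GRing.Theory.
Local Open Scope ring_scope.

Definition nabla (K : finFieldType) (F : K -> K) (a b : K) : nat :=
  #|[set X : K | F (X + a + b) - F (X + b) - F (X + a) + F X == 0]|.

Definition nabla_max (K : finFieldType) (F : K -> K) : nat :=
  (\max_(a : K | (a != 0)%R) \max_(b : K | (b != 0)%R) nabla F a b)%N.

Definition second_order_zero_differentially_uniform
    (K : finFieldType) (F : K -> K) (k : nat) : Prop :=
  nabla_max F = k.

(* Main.v *)
(** Write S for the automorphism x |-> x^t, t = 3^m, so that F X = X (S X)^2.
    In characteristic 3 the second difference of F at X = a Z + a + b is
    2 (S a) (c (S Z) + a (S b) Z) with c = a (S b) + (S a) b, so one has to count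
    the solutions of S Z = u Z, where u = - a (S b) / c.
    A nonzero solution gives u the norm u^(1 + t + ... + t^(n-1)) = 1.
    Conversely this exponent is odd, so norm 1 makes u a square v^2, and
    (3 t^2 - 1) - 3 (t + 1) (t - 1) = 2 together with 3 t^2 = 3^n yields
    v^2 = (v^-1)^(3 (t + 1) (t - 1)), an explicit solution. The same identity
    shows that w^t = w forces w^2 = 1, so solutions are unique up to sign. *)
Require Import Defs.
From mathcomp Require Import all_boot all_order all_algebra all_field ring.

Set Implicit Arguments.
Unset Strict Implicit.
Unset Printing Implicit Defensive.

Import GRing.Theory.
Local Open Scope ring_scope.

Lemma pchar3_2neq0 (R : nzRingType) : 3 \in [pchar R] -> 2 != 0 :> R.
Proof.
move=> ch; apply/eqP => h2; have /eqP := pcharf0 ch.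
by rewrite (natrD _ 2 1) h2 add0r oner_eq0.
Qed.

Lemma exprD_pow3 (R : comNzRingType) (m : nat) (x y : R) :
  3 \in [pchar R] -> (x + y) ^+ (3 ^ m) = x ^+ (3 ^ m) + y ^+ (3 ^ m).
Proof.
by move=> ch; apply: exprDn_pchar; rewrite (eq_pnat _ (pcharf_eq ch)) pnatX pnat_id.
Qed.

(** As 1/2 = -1 in characteristic 3, the shift by a + b centres the four points at a z. Since F is
    odd, the constant term then cancels and only terms linear in z and S z remain. *)
Lemma second_difference (R : comNzRingType) (m : nat) (a b z : R) :
  3 \in [pchar R] ->
  let F x := x ^+ (2 * 3 ^ m + 1) in
  let S x := x ^+ (3 ^ m) in
  let x := a * z + a + b in
  F (x + a + b) - F (x + b) - F (x + a) + F x =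
    2 * S a * ((a * S b + S a * b) * S z + a * S b * z).
Proof.
move=> ch /=; rewrite !addn1 !exprS !(mulnC 2) !exprM !(exprD_pow3 _ _ _ ch) !exprMn.
move: (pcharf0 ch); move: (a ^+ _) (b ^+ _) (z ^+ _) => A B Z h3.
apply/eqP; rewrite -subr_eq0; apply/eqP.
(* Over the integers the two sides differ by this explicit multiple of 3. *)
transitivity (3%:R * (2 * (a + b) * A * B + a * B ^+ 2 + b * A ^+ 2)); first by ring.
by rewrite h3 mul0r.
Qed.

Lemma odd_sum_expn (t n : nat) :
  odd t -> odd n -> odd (\sum_(0 <= j < n) t ^ j).
Proof.
move=> t_odd n_odd.
suff -> : odd (\sum_(0 <= j < n) t ^ j) = odd n by [].
elim: n {n_odd} => [|n IHn]; first by rewrite big_geq.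
by rewrite big_nat_recr //= oddD oddX t_odd orbT addbT IHn.
Qed.

(** Each further power t contributes one more factor u^(t^j). At k = n the right-hand side is z
    again, so z != 0 forces norm 1. *)
Lemma expr_geometric_sum (R : comNzRingType) (t k : nat) (u z : R) :
  z ^+ t = u * z -> u ^+ (\sum_(0 <= j < k) t ^ j) * z = z ^+ (t ^ k).
Proof.
move=> zt; elim: k => [|k IHk]; first by rewrite big_geq // mul1r.
by rewrite big_nat_recr //= exprD mulrAC IHk mulrC -exprMn -zt -exprM expnS.
Qed.

Lemma expf_card_exp (K : finFieldType) (q n m : nat) (x : K) :
  #|K| = (q ^ n)%N -> x ^+ ((q ^ m) ^ n) = x.
Proof.
move=> cardK; rewrite -expnM mulnC expnM -cardK.
by elim: m => [|m IHm]; rewrite ?expr1 // expnS exprM expf_card.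
Qed.

Section TwistedFixedPoints.

Variables (K : finFieldType) (n : nat).
Hypotheses (n_odd : odd n) (cardK : #|K| = (3 ^ n)%N).

Let m := (n.-1 %/ 2)%N.
Let t := (3 ^ m)%N.

Let ch3 : 3 \in [pchar K].
Proof. exact: card_finPcharP cardK _. Qed.

(** As n = 2m + 1, the total exponent 3 t^2 is the order of the field. *)
Lemma expf_cube_half (x : K) : ((x ^+ t) ^+ t) ^+ 3 = x.
Proof.
rewrite -!exprM mulnA -[RHS]expf_card cardK; congr (x ^+ _).
rewrite -expnD -expnSr; congr (3 ^ _)%N.
by rewrite /m divn2 addnn; case: (n) (n_odd) => //= k /even_halfK->.
Qed.

Lemma fixed_sqr1 (w : K) : w != 0 -> w ^+ t = w -> w ^+ 2 = 1.
Proof.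
move=> w0 wt; have := expf_cube_half w; rewrite !wt => w3.
by apply: (mulfI w0); rewrite mulr1 -exprS.
Qed.

Lemma sqr_twisted_fixed (v : K) :
  v != 0 -> exists2 z, z != 0 & z ^+ t = v ^+ 2 * z.
Proof.
(* Since v^(3 t^2) = v, both sides of the equation equal v^-1 (v^t)^-3 for this z. *)
move=> v0; exists ((v * v ^+ t) ^- 3); first by rewrite invr_eq0 !expf_neq0 ?mulf_neq0 ?expf_neq0.
have e := expf_cube_half v.
rewrite exprVn -exprM mulnC exprM [_ ^+ t]exprMn [_ ^+ 3]exprMn e.
rewrite exprMn; have := expf_neq0 t v0; move: (v ^+ t) => V V0.
by field; rewrite v0 V0.
Qed.

Lemma card_twisted_fixed (c e : K) : e != 0 ->
  #|[set z : K | c * z ^+ t + e * z == 0]| =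
    if (- e / c) ^+ (\sum_(0 <= j < n) t ^ j) == 1 then 3 else 1.
Proof.
move=> e0; set E := (\sum_(0 <= j < n) t ^ j)%N.
have t_odd : odd t by rewrite oddX orbT.
have E_odd : odd E by exact: odd_sum_expn.
have t_gt0 : (0 < t)%N by exact: odd_gt0.
have E_gt0 : (0 < E)%N by exact: odd_gt0.
have nz3 (z : K) : z != 0 -> z != - z.
  by move=> z0; rewrite -subr_eq0 opprK -mulr2n -mulr_natl mulf_neq0 // pchar3_2neq0.
have [/eqP c0|c0] := boolP (c == 0).
  (* With 0^-1 = 0 the base is 0, and as E > 0 its power is 0, not 1; the equation reduces to e z =
     0. *)
  rewrite c0 invr0 mulr0 expr0n -(negbK (E == 0)%N) -lt0n E_gt0 /= eq_sym oner_eq0.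
  rewrite -[RHS](cards1 (0 : K)); congr #|pred_of_set _|; apply/setP => z.
  by rewrite !inE mul0r add0r mulf_eq0 (negPf e0).
set u := - e / c.
have solE z : (c * z ^+ t + e * z == 0) = (z ^+ t == u * z).
  rewrite addr_eq0 -mulNr -(inj_eq (mulfI c0) (z ^+ t)) /u.
  by congr (_ == _); field.
have [/eqP uE|uE] := boolP (u ^+ E == 1); last first.
  rewrite -[RHS](cards1 (0 : K)); congr #|pred_of_set _|; apply/setP => z.
  rewrite !inE solE; apply/eqP/eqP => [zt|->]; last by rewrite expr0n mulr0 -(prednK t_gt0).
  apply/eqP; apply: contraNT uE => z0; apply/eqP; apply: (mulIf z0).
  by rewrite (expr_geometric_sum _ zt) (expf_card_exp _ _ cardK) mul1r.
have u0 : u != 0 by rewrite mulf_neq0 ?oppr_eq0 ?invr_eq0.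
(* The square root of u is v = u^((E+1)/2), because v^2 = u^E u = u. *)
have [z z0 zt] := sqr_twisted_fixed (expf_neq0 E.+1./2 u0).
have {}zt : z ^+ t = u * z.
  rewrite zt -exprM muln2 even_halfK ?exprS ?uE ?mulr1 //=.
  by rewrite E_odd.
transitivity #|[set 0; z; - z]|; last first.
  by rewrite -setUA cardsU1 cards2 nz3 // !inE ![0 == _]eq_sym oppr_eq0 (negPf z0).
congr #|pred_of_set _|; apply/setP => y; rewrite !inE solE.
apply/idP/idP => [/eqP yt|/orP[/orP[]|] /eqP->]; last 3 first.
- by rewrite expr0n mulr0 -(prednK t_gt0).
- by rewrite zt.
- by rewrite exprNn -signr_odd t_odd expr1 zt mulN1r mulrN.
have [//|y0 /=] := eqVneq y 0.
(* The factor u cancels in the quotient of two solutions, so the quotient is fixed by the power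
   t. *)
have w2 : (y / z) ^+ 2 = 1.
  apply: fixed_sqr1; first by rewrite mulf_neq0 ?invr_eq0.
  by rewrite exprMn exprVn yt zt; field; rewrite z0 u0.
have /eqP := w2; rewrite sqrf_eq1 => /orP[] /eqP yz.
  by rewrite -[y](divfK z0) yz mul1r eqxx.
by rewrite -[y](divfK z0) yz mulN1r eqxx orbT.
Qed.

End TwistedFixedPoints.

Theorem theorem3p8 (n : nat) (n_odd : odd n)
    (K : finFieldType) (cardK : #|K| = (3 ^ n)%N) :
  let m := (n.-1 %/ 2)%N in
  let d := (2 * 3 ^ m + 1)%N in
  let F := fun X : K => X ^+ d in
  (forall a b : K,
     nabla F a b =
       if a * b == 0 then (3 ^ n)%N
       else if (- (a * b ^+ (3 ^ m))
                / (a * b ^+ (3 ^ m) + a ^+ (3 ^ m) * b))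
               ^+ (\sum_(0 <= j < n) 3 ^ (j * m))%N == 1
       then 3%N
       else 1%N)
  /\ second_order_zero_differentially_uniform F 3.
Proof.
move=> m d F.
have ch3 : 3 \in [pchar K] by exact: card_finPcharP cardK _.
have nablaE (a b : K) : nabla F a b =
    if a * b == 0 then (3 ^ n)%N
    else if (- (a * b ^+ (3 ^ m))
             / (a * b ^+ (3 ^ m) + a ^+ (3 ^ m) * b))
            ^+ (\sum_(0 <= j < n) 3 ^ (j * m))%N == 1
    then 3%N
    else 1%N.
  rewrite /nabla; have [|] := boolP (a * b == 0).
    rewrite mulf_eq0 -cardK -cardsT => ab0.
    congr #|pred_of_set _|; apply/setP => X; rewrite !inE.
    case/orP: ab0 => /eqP->; rewrite !addr0; first by rewrite subrr add0r addNr eqxx.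
    by rewrite [_ - _ - _]addrAC subrr add0r addNr eqxx.
  rewrite mulf_eq0 negb_or => /andP[a0 b0].
  have e0 : a * b ^+ (3 ^ m) != 0 by rewrite mulf_neq0 ?expf_neq0.
  under eq_bigr do rewrite mulnC expnM.
  rewrite -(card_twisted_fixed n_odd cardK _ e0) -/m.
  set A := [set X | _]; set B := [set z | _].
  (* This affine substitution is a bijection as a != 0, so it preserves the number of solutions. *)
  pose f z := a * z + a + b.
  have f_inj : injective f.
    by move=> x y /addIr/addIr/(mulfI a0).
  rewrite -(card_imset B f_inj); congr #|pred_of_set _|; apply/setP => X.
  have -> : X = f ((X - a - b) / a) by rewrite /f; field.
  rewrite mem_imset // !inE /f second_difference //.
  by rewrite !mulf_eq0 (negPf (pchar3_2neq0 ch3)) (negPf (expf_neq0 _ a0)).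
split=> //; apply/eqP; rewrite eqn_leq; apply/andP; split.
  apply/bigmax_leqP => a a0; apply/bigmax_leqP => b b0.
  by rewrite nablaE mulf_eq0 (negPf a0) (negPf b0) /=; case: ifP.
(* The bound 3 is attained at a = b = 1, where the ratio is -1/2 = 1. *)
rewrite /nabla_max (bigD1 1) ?oner_eq0 //= leq_max; apply/orP; left.
rewrite (bigD1 1) ?oner_eq0 //= leq_max nablaE mulr1 oner_eq0 !expr1n mulr1.
have -> : - 1 / (1 + 1) = 1 :> K; last by rewrite expr1n eqxx.
have -> : 1 + 1 = - 1 :> K by apply/eqP; rewrite -subr_eq0 opprK -[X in _ == X](pcharf0 ch3); apply/eqP; ring.
by rewrite divff // oppr_eq0 oner_eq0.
Qed.
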